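(* If the kernel $k$ (with $k(0)=0$) belongs to one of the following classes, then the corresponding operator $\mathcal{L}$ satisfies the $CD(0,d)$-inequality for some finite $d>0$. (i) Power type kernels: $k(j)=\frac{c}{|j|^{1+\beta}}$, $j\in\mathbb{Z}\setminus\{0\}$, where $c>0$ and $\beta>2$. (ii) Exponential kernels: $k(j)=c\,e^{-\delta|j|^\alpha}$, $j\in\mathbb{Z}\setminus\{0\}$, where $c,\alpha,\delta>0$. (iii) Mixed exponential and power type: $k(j)=c\,\frac{e^{-\delta|j|}}{|j|^\alpha}$, $j\in\mathbb{Z}\setminus\{0\}$, where $c,\alpha,\delta>0$.
   Context: A kernel is a function $k:\mathbb{Z}\to[0,\infty)$ with $k(0)=0$, $k(-j)=k(j)$ for all $j\in\mathbb{N}$, and $0<|k|_1:=\sum_{j\in\mathbb{Z}}k(j)<\infty$. The associated operator is $\mathcal{L}u(x)=\sum_{j\in\mathbb{Z}}k(j)\big(u(x+j)-u(x)\big)$, $x\in\mathbb{Z}$, and the iterated carré du champ operator is given by $\Gamma_2(u)(x)=\frac14\sum_{j,l\in\mathbb{Z}}k(j)k(l)\big(u(x+j+l)-u(x+j)-u(x+l)+u(x)\big)^2\in[0,\infty]$. A function $u:\mathbb{Z}\to\mathbb{R}$ is admissible for $CD(0,d)$ at $x\in\mathbb{Z}$ if $\sum_{j\in\mathbb{Z}}k(j)|u(x+j)|<\infty$. For $d\in(0,\infty)$, $\mathcal{L}$ satisfies $CD(0,d)$ if $\Gamma_2(u)(x)\ge\frac1d\big(\mathcal{L}u(x)\big)^2$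 for every $x\in\mathbb{Z}$ and every $u$ admissible at $x$. *)

(* Defs.v *)
From HB Require Import structures.
From mathcomp Require Import all_boot all_order all_algebra.
From mathcomp Require Import all_classical all_reals all_analysis.
Set Implicit Arguments.
Unset Strict Implicit.
Unset Printing Implicit Defensive.
Import Order.TTheory GRing.Theory Num.Theory.
Local Open Scope classical_set_scope.
Local Open Scope ring_scope.

(* \sum_(j in Z) f j for an absolutely summable real family f, as the sum of
   the positive parts minus the sum of the negative parts; only meaningful
   when f is absolutely summable, since fine sends infinite values to 0. *)
Definition zsum (R : realType) (f : int -> R) : R :=
  fine (\esum_(j in [set: int]) ((EFin \o f)^\+ j)%E
        - \esum_(j in [set: int]) ((EFin \o f)^\- j)%E)%E.

Definition is_kernel (R : realType) (k : int -> R) : Prop :=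
  [/\ forall j, 0 <= k j,
      k 0 = 0,
      forall j, k (- j) = k j &
      (0 < \esum_(j in [set: int]) (k j)%:E < +oo)%E].

Definition nonlocal_op (R : realType) (k : int -> R) (u : int -> R)
    (x : int) : R :=
  zsum (fun j => k j * (u (x + j) - u x)).

Definition Gamma2 (R : realType) (k : int -> R) (u : int -> R)
    (x : int) : \bar R :=
  ((4^-1)%:E * \esum_(p in [set: int * int])
     (k p.1 * k p.2 *
      (u (x + p.1 + p.2) - u (x + p.1) - u (x + p.2) + u x) ^+ 2)%:E)%E.

Definition admissible (R : realType) (k : int -> R) (u : int -> R)
    (x : int) : Prop :=
  (\esum_(j in [set: int]) (k j * `|u (x + j)|)%:E < +oo)%E.

Definition CD0 (R : realType) (k : int -> R) (d : R) : Prop :=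
  forall (x : int) (u : int -> R), admissible k u x ->
    ((d^-1 * nonlocal_op k u x ^+ 2)%:E <= Gamma2 k u x)%E.

Definition power_kernel (R : realType) (k : int -> R) : Prop :=
  exists c beta : R, [/\ 0 < c, 2 < beta &
    forall j : int, j != 0 -> k j = c / (`|j|%:~R `^ (1 + beta))].

Definition exp_kernel (R : realType) (k : int -> R) : Prop :=
  exists c alpha delta : R, [/\ 0 < c, 0 < alpha, 0 < delta &
    forall j : int, j != 0 -> k j = c * expR (- delta * (`|j|%:~R `^ alpha))].

Definition exp_power_kernel (R : realType) (k : int -> R) : Prop :=
  exists c alpha delta : R, [/\ 0 < c, 0 < alpha, 0 < delta &
    forall j : int, j != 0 ->
      k j = c * (expR (- delta * `|j|%:~R) / (`|j|%:~R `^ alpha))].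

(* Main.v *)
Require Import Defs.
From mathcomp Require Import all_boot all_order all_algebra.
From mathcomp Require Import all_classical all_reals all_analysis.
From mathcomp Require Import ring lra zify.
Import Order.TTheory GRing.Theory Num.Theory.
Local Open Scope classical_set_scope.
Local Open Scope ring_scope.

(** Fix [x] and write [w j = u (x + j) + u (x - j) - 2 u x].  Since [k] is
    even, [L u x] is half the sum of [k j * w j] over the integers, so only [w]
    has to be controlled by the mixed differences
    [D (j, l) = u (x + j + l) - u (x + j) - u (x + l) + u x] whose weighted
    squares make up [Gamma2].

    Two families of mixed differences suffice.  First, [D (1, -1) = - w 1], so
    [G = Gamma2 k u x] bounds [w 1].  Second,
    [D (j, 1) + D (- j, -1) = w (j + 1) - w j - w 1 =: e j], so [G] bounds the
    sum of [k j * e j ^ 2] over [j > 0].  Telescoping gives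
    [w n = n * w 1 + e 1 + ... + e (n - 1)].  When [k] is nonincreasing on the
    positive integers, [k n <= k j] for [j < n], and the Cauchy-Schwarz
    inequality yields [k n * w n ^ 2 <= A * G * n] for a constant [A]
    depending only on [k] ([sym_diff_growth]).  Multiplying by [k n] and taking
    square roots, [k n * |w n| <= sqrt (A * G) * sqrt (n * k n)].

    Hence a kernel that is nonincreasing on the positive integers satisfies
    CD(0, d) for some finite [d] as soon as the sum of [sqrt (|j| * k j)] is
    finite ([CD0_of_nonincreasing]).  For [k j = c / |j| ^ (1 + beta)] this is
    the convergence of the series of [j ^ (- beta / 2)], which is exactly
    [beta > 2]; the exponential classes decay faster than any power
    ([expR_decay]).  All three are nonincreasing in [|j|]. *)

(** * Sums over countable index types *)

Lemma le_esum_scale (R : realType) (T : choiceType) (a b : T -> R) (c : R) :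
  0 <= c -> (forall i, 0 <= b i) -> (forall i, a i <= c * b i) ->
  (\esum_(i in [set: T]) (a i)%:E
    <= c%:E * \esum_(i in [set: T]) (b i)%:E)%E.
Proof.
move=> c0 b0 ab; apply: ge_ereal_sup => /= _ [X [finX XT]] <-.
apply: (@le_trans _ _ (c%:E * \sum_(i \in X) (b i)%:E)%E); last first.
  by rewrite lee_wpmul2l ?lee_fin//; apply: ereal_sup_ubound; exists X.
rewrite ge0_mule_fsumr; last by move=> i; rewrite lee_fin.
by apply: lee_fsum => // i _; rewrite -EFinM lee_fin.
Qed.

Lemma sum_inj_le_esum (R : realType) (T : choiceType) (a : T -> R)
    (h : nat -> T) n :
  (forall i, 0 <= a i) -> injective h ->
  ((\sum_(i < n) a (h i))%:E <= \esum_(i in [set: T]) (a i)%:E)%E.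
Proof.
move=> a0 hinj.
apply: (@le_trans _ _ (\esum_(i in range h) (a i)%:E)%E).
  rewrite esum_image; last by move=> x y _ _ /hinj.
  rewrite -nneseries_esumT; last by move=> i; rewrite lee_fin.
  rewrite -sumEFin -(big_mkord xpredT (fun i => (a (h i))%:E)).
  by apply: nneseries_lim_ge => i _ _; rewrite lee_fin.
rewrite [leRHS](esumID (range h)); last by move=> i _; rewrite lee_fin.
by rewrite setTI leeDl// esum_ge0// => i _; rewrite lee_fin.
Qed.

(** An even family is determined by its restrictions to the images of [Posz]
    and [Negz], and both of these are dominated by the partial sums over the
    natural numbers. *)
Lemma esum_int_even_lty (R : realType) (f : int -> R) (M : R) :
  (forall j, 0 <= f j) -> (forall j, f (- j) = f j) ->
  (forall n, \sum_(i < n) f i%:Z <= M) ->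
  (\esum_(j in [set: int]) (f j)%:E < +oo)%E.
Proof.
move=> f0 feven fM.
have bound (h : nat -> int) (B : R) : injective h ->
    (forall n, \sum_(i < n) f (h i) <= B) ->
    (\esum_(j in range h) (f j)%:E < +oo)%E.
  move=> hinj hB; apply: (@le_lt_trans _ _ B%:E); last by rewrite ltry.
  rewrite esum_image; last by move=> x y _ _ /hinj.
  rewrite -nneseries_esumT; last by move=> i; rewrite lee_fin.
  apply: lime_le.
    by apply: is_cvg_nneseries => i _ _; rewrite lee_fin.
  by apply: nearW => n; rewrite big_mkord sumEFin lee_fin.
rewrite (esumID (range Posz)); last by move=> i _; rewrite lee_fin.
apply: lte_add_pinfty; rewrite setTI.
  by apply: (bound _ M) => // x y [].
apply: (@le_lt_trans _ _ (\esum_(j in range Negz) (f j)%:E)%E).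
  have -> : ~` (range Posz) = range Negz; last by [].
  apply/seteqP; split=> [[j|j] //= nj|_ [j _ <-] [] //].
  - by exfalso; apply: nj; exists j.
  - by exists j.
apply: (bound _ M) => [x y []//|n].
(* Negz i is - i.+1, so these are the terms of fM n.+1 without the first *)
apply: le_trans (fM n.+1); rewrite big_ord_recl -[leLHS]add0r lerD ?f0//.
by apply: ler_sum => i _; rewrite NegzE feven.
Qed.

(** Reindexing by [j -> - j] leaves each of the two sums [P] and [M] over
    positive and negative parts unchanged, so [P + P] and [M + M] are the sums
    of the parts of [f j] and [f (- j)] together; termwise these differ by
    [f j + f (- j)]. *)
Lemma zsum_le_symmetric (R : realType) (f : int -> R) (S : R) :
  (\esum_(j in [set: int]) (`|f j|)%:E < +oo)%E ->
  (\esum_(j in [set: int]) (`|f j + f (- j)|)%:E <= S%:E)%E ->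
  `|zsum f| <= S / 2.
Proof.
move=> fsum fS.
set P := \esum_(j in [set: int]) ((EFin \o f)^\+ j)%E.
set M := \esum_(j in [set: int]) ((EFin \o f)^\- j)%E.
have Pfin : P \is a fin_num.
  rewrite ge0_fin_numE; last by apply: esum_ge0 => j _; exact: funepos_ge0.
  apply: le_lt_trans fsum; apply: le_esum => j _.
  by rewrite funeposE /= -EFin_max lee_fin ge_max ler_norm normr_ge0.
have Mfin : M \is a fin_num.
  rewrite ge0_fin_numE; last by apply: esum_ge0 => j _; exact: funeneg_ge0.
  apply: le_lt_trans fsum; apply: le_esum => j _.
  by rewrite funenegE /= -EFin_max lee_fin ge_max -[`|_|]normrN ler_norm normr_ge0.
have oppbij : set_bij [set: int] [set: int] (@GRing.opp int).
  split=> [//|x y _ _ /oppr_inj//|x _]; by exists (- x) => //; rewrite opprK.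
have posneg (a : R) : Num.max a 0 - Num.max (- a) 0 = a.
  by case: (leP a 0) => a0; [rewrite max_l|rewrite max_r]; lra.
have PP : (P + P = \esum_(j in [set: int])
    ((EFin \o f)^\+ j + (EFin \o f)^\+ (- j)%R))%E.
  rewrite esumD; [|by move=> j _; exact: funepos_ge0..].
  by rewrite [in LHS]/P {2}(reindex_esum _ _ _ _ oppbij).
have MM : (M + M = \esum_(j in [set: int])
    ((EFin \o f)^\- j + (EFin \o f)^\- (- j)%R))%E.
  rewrite esumD; [|by move=> j _; exact: funeneg_ge0..].
  by rewrite [in LHS]/M {2}(reindex_esum _ _ _ _ oppbij).
have PM : (P + P <= M + M + S%:E)%E.
  rewrite PP MM; apply: (le_trans _ (leeD2l _ fS)).
  rewrite -esumD; last 2 first.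
  - by move=> j _; rewrite adde_ge0// funeneg_ge0.
  - by move=> j _; rewrite lee_fin.
  apply: le_esum => j _.
  rewrite !funeposE !funenegE /= -!EFin_max -!EFinD lee_fin.
  have := ler_norm (f j + f (- j)).
  have := posneg (f j); have := posneg (f (- j)); lra.
have MP : (M + M <= P + P + S%:E)%E.
  rewrite PP MM; apply: (le_trans _ (leeD2l _ fS)).
  rewrite -esumD; last 2 first.
  - by move=> j _; rewrite adde_ge0// funepos_ge0.
  - by move=> j _; rewrite lee_fin.
  apply: le_esum => j _.
  rewrite !funeposE !funenegE /= -!EFin_max -!EFinD lee_fin.
  have := ler_norm (- (f j + f (- j))); rewrite normrN.
  have := posneg (f j); have := posneg (f (- j)); lra.
rewrite /zsum -/P -/M fineB//.
move: PM MP; rewrite -(fineK Pfin) -(fineK Mfin) -!EFinD !lee_fin /=.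
rewrite ler_norml => *; apply/andP; split; lra.
Qed.

(** * Growth of symmetric second differences *)

(** Cauchy-Schwarz against the constant sequence 1. *)
Lemma sqr_sum_le (R : realType) (e : nat -> R) n :
  (\sum_(i < n) e i) ^+ 2 <= n%:R * \sum_(i < n) e i ^+ 2.
Proof.
elim: n => [|n IHn]; first by rewrite !big_ord0 expr0n mul0r.
rewrite !big_ord_recr /= sqrrD -[n.+1%:R]natr1 mulrDl mul1r mulrDr.
(* the cross term is split by 2 * e i * e n <= e i ^ 2 + e n ^ 2 *)
suff cross : (\sum_(i < n) e i) * e n *+ 2
    <= \sum_(i < n) e i ^+ 2 + n%:R * e n ^+ 2 by lra.
rewrite mulr_suml -sumrMnl [n%:R * _]mulr_natl.
have -> : e n ^+ 2 *+ n = \sum_(i < n) e n ^+ 2.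
  by rewrite sumr_const card_ord.
rewrite -big_split /=; apply: ler_sum => i _.
have := sqr_ge0 (e i - e n); rewrite sqrrB; lra.
Qed.

Definition mixed_diff {R : realType} (u : int -> R) (x : int)
    (p : int * int) : R :=
  u (x + p.1 + p.2) - u (x + p.1) - u (x + p.2) + u x.

Definition sym_diff {R : realType} (u : int -> R) (x j : int) : R :=
  u (x + j) + u (x - j) - 2 * u x.

Lemma sum_le_Gamma2 (R : realType) (k u : int -> R) (x : int) (G : R)
    (h : nat -> int * int) n :
  is_kernel k -> injective h -> Gamma2 k u x = G%:E ->
  \sum_(i < n) k (h i).1 * k (h i).2 * mixed_diff u x (h i) ^+ 2 <= 4 * G.
Proof.
move=> [k0 _ _ _] hinj.
rewrite /Gamma2; set E := esum _ _ => GE.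
have le_E := @sum_inj_le_esum R _
  (fun p => k p.1 * k p.2 * mixed_diff u x p ^+ 2) h n _ hinj.
have E4 : E = (4 * G)%:E.
  by rewrite EFinM -GE muleA -EFinM mulfV// mul1e.
rewrite -lee_fin -E4; apply: le_E => p.
by rewrite mulr_ge0 ?sqr_ge0// mulr_ge0.
Qed.

(** [Gamma2] is used through three of its subfamilies: the pair [(1, -1)]
    bounds [sym_diff u x 1], while [(j, 1)] and [(- j, -1)] bound the defects
    [e] from additivity of the symmetric difference.  Monotonicity lets the
    weight [k n] be replaced by [k j] inside the sum of [e j ^ 2]; the linear
    part [n * w 1] costs a factor [n ^ 2], one power of which is absorbed by
    the bound [B] on [n * k n]. *)
Lemma sym_diff_growth (R : realType) (k u : int -> R) (x : int) (G B : R) n :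
  is_kernel k -> 0 < k 1 ->
  (forall i j : nat, (0 < i <= j)%N -> k j%:Z <= k i%:Z) ->
  Gamma2 k u x = G%:E -> n.+1%:R * k n.+1%:Z <= B ->
  k n.+1%:Z * sym_diff u x n.+1%:Z ^+ 2
    <= (8 * B / k 1 ^+ 2 + 32 / k 1) * G * n.+1%:R.
Proof.
move=> hk k1 kdec GE kB; have [k0 _ keven _] := hk.
have G0 : 0 <= G.
  have := @sum_le_Gamma2 R k u x G (fun i => (i%:Z, 0)) 0 hk _ GE.
  by rewrite big_ord0 pmulr_rge0//; apply => i j [].
pose w i := sym_diff u x i%:Z.
(* e i is the defect at j = i + 1, the family being indexed from 0 *)
pose e i := w i.+2 - w i.+1 - w 1%N.
have sum_e m : w m.+1 = m.+1%:R * w 1%N + \sum_(i < m) e i.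
  elim: m => [|m IHm]; first by rewrite big_ord0 mul1r addr0.
  by rewrite big_ord_recr /= -[m.+2%:R]natr1 /e; lra.
have w1 : k 1 ^+ 2 * w 1%N ^+ 2 <= 4 * G.
  have := @sum_le_Gamma2 R k u x G (fun i => (i.+1%:Z, -1)) 1 hk _ GE.
  rewrite big_ord1 /= keven /mixed_diff /= addrK.
  have -> : u x - u (x + 1) - u (x - 1) + u x = - w 1%N.
    by rewrite /w /sym_diff; ring.
  by rewrite sqrrN -expr2; apply => i j [].
have se : k 1 * \sum_(i < n) k i.+1%:Z * e i ^+ 2 <= 16 * G.
  have := @sum_le_Gamma2 R k u x G (fun i => (i.+1%:Z, 1)) n hk _ GE.
  have := @sum_le_Gamma2 R k u x G (fun i => (- i.+1%:Z, -1)) n hk _ GE.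
  move=> /(_ _)/[swap]; set T1 := \sum_(i < n) _ => T1G.
  set T2 := \sum_(i < n) _ => T2G.
  suff : k 1 * \sum_(i < n) k i.+1%:Z * e i ^+ 2 <= 2 * (T1 + T2).
    have : T1 <= 4 * G by apply: T1G => i j [].
    have : T2 <= 4 * G by apply: T2G => i j [].
    lra.
  rewrite /T1 /T2 -big_split /= !mulr_sumr; apply: ler_sum => i _.
  rewrite !keven.
  set d1 := mixed_diff _ _ _; set d2 := mixed_diff _ _ _.
  have -> : e i = d1 + d2.
    rewrite /e /w /sym_diff /d1 /d2 /mixed_diff /=.
    have -> : x + i.+2%:Z = x + i.+1%:Z + 1 by rewrite -addrA; congr (_ + _); lia.
    have -> : x - i.+2%:Z = x - i.+1%:Z - 1 by rewrite -addrA; congr (_ + _); lia.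
    ring.
  have kk : 0 <= k i.+1%:Z * k 1 by rewrite mulr_ge0.
  have := mulr_ge0 kk (sqr_ge0 (d1 - d2)); lra.
have kS : k n.+1%:Z * (\sum_(i < n) e i) ^+ 2 <= n.+1%:R * (16 * G / k 1).
  apply: (@le_trans _ _ (k n.+1%:Z * (n%:R * \sum_(i < n) e i ^+ 2))).
    by rewrite ler_wpM2l// sqr_sum_le.
  apply: (@le_trans _ _ (n%:R * (16 * G / k 1))); last first.
    by rewrite ler_wpM2r ?ler_nat// divr_ge0 ?mulr_ge0// ltW.
  rewrite mulrCA ler_wpM2l// ler_pdivlMr// mulrC.
  apply: le_trans se; rewrite ler_wpM2l// mulr_sumr; apply: ler_sum => i _.
  by rewrite ler_wpM2r ?sqr_ge0// kdec//= ltnW// ltnS.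
have kw : k n.+1%:Z * (n.+1%:R * w 1%N) ^+ 2
    <= n.+1%:R * (B * (4 * G / k 1 ^+ 2)).
  have -> : k n.+1%:Z * (n.+1%:R * w 1%N) ^+ 2
     = n.+1%:R * ((n.+1%:R * k n.+1%:Z) * w 1%N ^+ 2) by ring.
  rewrite ler_wpM2l// ler_pM ?sqr_ge0 ?mulr_ge0//.
  by rewrite ler_pdivlMr ?exprn_gt0// mulrC.
have : k n.+1%:Z * w n.+1 ^+ 2 <= 2 * (k n.+1%:Z * (n.+1%:R * w 1%N) ^+ 2
     + k n.+1%:Z * (\sum_(i < n) e i) ^+ 2).
  rewrite sum_e.
  have := mulr_ge0 (k0 n.+1%:Z) (sqr_ge0 (n.+1%:R * w 1%N - \sum_(i < n) e i)).
  lra.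
rewrite -/(w n.+1); lra.
Qed.

(** * A sufficient condition for monotone kernels *)

Lemma sym_diffN {R : realType} (u : int -> R) (x j : int) :
  sym_diff u x (- j) = sym_diff u x j.
Proof. by rewrite /sym_diff opprK [u _ + u _]addrC. Qed.

Lemma kernel1_gt0 (R : realType) (k : int -> R) :
  is_kernel k ->
  (forall i j : nat, (0 < i <= j)%N -> k j%:Z <= k i%:Z) ->
  0 < k 1.
Proof.
move=> [k0 k00 keven /andP[kpos _]] kdec.
rewrite lt_neqAle k0 andbT; apply/negP => /eqP k10.
suff kz j : k j = 0.
  by move: kpos; rewrite esum1 ?ltxx// => j _; rewrite kz.
have kS n : k n.+1%:Z = 0.
  by apply/eqP; rewrite eq_le k0 andbT [leRHS]k10; exact: (kdec 1%N n.+1).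
by case: j => [[|n]|n]; rewrite ?NegzE ?keven.
Qed.

(** Summing the pointwise bound of [sym_diff_growth] turns the finite sum [Z]
    of [sqrt (|j| * k j)] into a bound of [|L u x|] by
    [sqrt (A * Gamma2) * Z / 2].  The square of [Z] bounds [n * k n], whose
    root is a single term of the series. *)
Lemma CD0_of_nonincreasing (R : realType) (k : int -> R) :
  is_kernel k ->
  (forall i j : nat, (0 < i <= j)%N -> k j%:Z <= k i%:Z) ->
  (\esum_(j in [set: int]) (Num.sqrt (`|j|%:~R * k j))%:E < +oo)%E ->
  exists d : R, 0 < d /\ CD0 k d.
Proof.
move=> hk kdec; have k1 := kernel1_gt0 _ _ hk kdec.
have [k0 k00 keven /andP[_ kfin]] := hk.
set Ze := esum _ _ => Zfin.
have Ze0 : (0 <= Ze)%E by apply: esum_ge0 => j _; rewrite lee_fin sqrtr_ge0.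
pose Z := fine Ze; have ZE : Ze = Z%:E by rewrite fineK// ge0_fin_numE.
have Z0 : 0 <= Z by exact: fine_ge0.
have kZ n : n.+1%:R * k n.+1%:Z <= Z ^+ 2.
  rewrite -[leLHS]sqr_sqrtr ?mulr_ge0// lerXn2r ?nnegrE ?sqrtr_ge0//.
  rewrite -lee_fin -ZE; apply: le_trans (@sum_inj_le_esum R _
    (fun j : int => Num.sqrt (`|j|%:~R * k j)) (fun i => (n + i).+1%:Z) 1 _ _).
  - by rewrite big_ord1 lee_fin/= addn0.
  - by move=> j; rewrite sqrtr_ge0.
  - by move=> i j [] /addnI.
set A := 8 * Z ^+ 2 / k 1 ^+ 2 + 32 / k 1.
have A0 : 0 <= A.
  by rewrite addr_ge0// divr_ge0 ?mulr_ge0 ?exprn_ge0 ?(ltW k1).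
(* the square of Z * sqrt A / 2; the added 1 only secures positivity *)
pose d := Z ^+ 2 * A / 4 + 1.
have d0 : 0 < d by rewrite ltr_wpDl// divr_ge0 ?mulr_ge0 ?exprn_ge0.
exists d; split=> // x u uadm.
have G0 : (0 <= Gamma2 k u x)%E.
  rewrite /Gamma2 mule_ge0 ?lee_fin ?invr_ge0// esum_ge0// => p _.
  by rewrite lee_fin mulr_ge0 ?sqr_ge0// mulr_ge0.
case GE : (Gamma2 k u x) G0 => [G| |//] G0; last by rewrite leey.
rewrite !lee_fin in G0 *.
have term j : k j * `|sym_diff u x j|
    <= Num.sqrt (A * G) * Num.sqrt (`|j|%:~R * k j).
  have pos n : k n.+1%:Z * `|sym_diff u x n.+1%:Z|
      <= Num.sqrt (A * G) * Num.sqrt (n.+1%:R * k n.+1%:Z).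
    rewrite -sqrtrM ?mulr_ge0// -[leLHS]ger0_norm ?mulr_ge0//.
    rewrite -sqrtr_sqr ler_wsqrtr// exprMn real_normK ?num_real//.
    have := sym_diff_growth R k u x G (Z ^+ 2) n hk k1 kdec GE (kZ n).
    rewrite -/A => /(ler_wpM2l (k0 n.+1%:Z)); lra.
  case: j => [[|n]|n]; first by rewrite k00 mul0r mulr_ge0 ?sqrtr_ge0.
    exact: pos.
  by rewrite NegzE keven sym_diffN normrN; exact: pos.
(* admissibility together with the finite mass of k makes the family defining
   L u x absolutely summable *)
have LZ : `|nonlocal_op k u x| <= Num.sqrt (A * G) * Z / 2.
  apply: zsum_le_symmetric.
    apply: (@le_lt_trans _ _ (\esum_(j in [set: int])
      ((k j * `|u (x + j)|)%:E + (k j * `|u x|)%:E)%E)).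
      apply: le_esum => j _.
      by rewrite -EFinD lee_fin normrM ger0_norm// -mulrDr ler_wpM2l// ler_normB.
    rewrite esumD; [|by move=> j _; rewrite lee_fin mulr_ge0..].
    apply: lte_add_pinfty => //.
    apply: (@le_lt_trans _ _ (`|u x|%:E * \esum_(j in [set: int]) (k j)%:E)%E).
      by apply: le_esum_scale => // j; rewrite mulrC.
    by rewrite lte_mul_pinfty ?lee_fin// fin_numE.
  rewrite EFinM -ZE.
  apply: (@le_trans _ _ (\esum_(j in [set: int]) (k j * `|sym_diff u x j|)%:E)).
    apply: le_esum => j _; rewrite lee_fin keven -mulrDr normrM ger0_norm//.
    rewrite (_ : sym_diff u x j = u (x + j) - u x + (u (x - j) - u x))//.
    by rewrite /sym_diff; ring.
  by apply: le_esum_scale; rewrite ?sqrtr_ge0// => j; rewrite sqrtr_ge0.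
rewrite mulrC ler_pdivrMr//.
have : nonlocal_op k u x ^+ 2 <= (Num.sqrt (A * G) * Z / 2) ^+ 2.
  rewrite -[leLHS]real_normK ?num_real// lerXn2r// nnegrE.
  by rewrite !mulr_ge0 ?sqrtr_ge0 ?invr_ge0.
rewrite !exprMn sqr_sqrtr ?mulr_ge0// /d; lra.
Qed.

(** * Power and exponential decay *)

(** The quotient of the two powers on the right is
    [expR (- t * ln (1 - 1 / (a + 1)))], and [expR y >= 1 + y] together with
    [ln (1 + y) <= y] bounds it below by [1 + t / (a + 1)]. *)
Lemma invpowR_telescope (R : realType) (a t : R) : 0 < a -> 0 < t ->
  t * (a + 1) `^ (- (1 + t)) <= a `^ (- t) - (a + 1) `^ (- t).
Proof.
move=> a0 t0; have a10 : 0 < a + 1 by rewrite addr_gt0.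
have -> : (a + 1) `^ (- (1 + t)) = (a + 1)^-1 * (a + 1) `^ (- t).
  by rewrite opprD powRD ?(gt_eqF a10) ?implybT// powR_inv1// ltW.
have -> : a `^ (- t) = (1 + - (a + 1)^-1) `^ (- t) * (a + 1) `^ (- t).
  rewrite -powRM ?(ltW a10)//.
    congr (_ `^ _); field; lra.
  by rewrite subr_ge0 invf_le1// lerDr ltW.
suff : 1 + t * (a + 1)^-1 <= (1 + - (a + 1)^-1) `^ (- t).
  move=> /(ler_wpM2r (powR_ge0 (a + 1) (- t))); lra.
have b1 : 0 < 1 + - (a + 1)^-1.
  by rewrite subr_gt0 invf_lt1// ltrDr.
rewrite /powR gt_eqF//; apply: le_trans (expR_ge1Dx _).
rewrite lerD2l mulNr -mulrN ler_wpM2l ?(ltW t0)// lerNr.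
by apply: le_ln1Dx; lra.
Qed.

(** The first term is 1 and the others telescope. *)
Lemma sum_invpowR_le (R : realType) (t : R) n : 0 < t ->
  \sum_(i < n) i.+1%:R `^ (- (1 + t)) <= 1 + t^-1.
Proof.
move=> t0; have powge0 (i : nat) (s : R) : 0 <= i%:R `^ s by exact: powR_ge0.
apply: (@le_trans _ _ (\sum_(i < n.+1) i.+1%:R `^ (- (1 + t)))).
  by rewrite big_ord_recr lerDl.
(* the sharper bound with the telescoped remainder is what goes through the
   induction *)
apply: (@le_trans _ _ (1 + t^-1 * (1 - n.+1%:R `^ (- t)))); last first.
  by rewrite lerD2l ler_piMr ?invr_ge0 ?(ltW t0)// gerBl.
elim: n => [|n IHn]; first by rewrite big_ord1 powR1 subrr mulr0 addr0.
rewrite big_ord_recr /=.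
have := @invpowR_telescope R n.+1%:R t (ltr0Sn _ _) t0.
rewrite natr1 -(ler_pM2l (_ : 0 < t^-1)) ?invr_gt0// mulKf ?gt_eqF//.
lra.
Qed.


(** [sqrt (n * n ^ (- (1 + beta))) = n ^ (- beta / 2)], and [beta / 2 > 1]. *)
Lemma CD0_of_power_decay (R : realType) (k : int -> R) (C beta : R) :
  is_kernel k ->
  (forall i j : nat, (0 < i <= j)%N -> k j%:Z <= k i%:Z) ->
  2 < beta -> 0 <= C ->
  (forall n : nat, k n.+1%:Z <= C * n.+1%:R `^ (- (1 + beta))) ->
  exists d : R, 0 < d /\ CD0 k d.
Proof.
move=> hk kdec beta2 C0 kC; have [k0 k00 keven _] := hk.
apply: CD0_of_nonincreasing => //.
pose t := beta / 2 - 1; have t0 : 0 < t by rewrite /t; lra.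
apply: (@esum_int_even_lty R _ (Num.sqrt C * (1 + t^-1))).
- by move=> j; rewrite sqrtr_ge0.
- by move=> j; rewrite normrN keven.
move=> n; apply: le_trans (ler_wpM2l (sqrtr_ge0 C) (sum_invpowR_le R t n t0)).
apply: (@le_trans _ _
    (\sum_(i < n.+1) Num.sqrt (`|i%:Z|%:~R * k i%:Z))).
  by rewrite big_ord_recr lerDl sqrtr_ge0.
rewrite big_ord_recl/= mul0r sqrtr0 add0r mulr_sumr.
apply: ler_sum => i _.
have -> : i.+1%:R `^ (- (1 + t)) = Num.sqrt (i.+1%:R * i.+1%:R `^ (- (1 + beta))) :> R.
  rewrite -[X in X * _]powRr1// -powRD ?pnatr_eq0 ?implybT//.
  rewrite -powR12_sqrt ?powR_ge0// -powRrM; congr (_ `^ _).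
  by rewrite /t; lra.
rewrite -sqrtrM// ler_wsqrtr//.
have -> : C * (i.+1%:R * i.+1%:R `^ (- (1 + beta))) =
   i.+1%:R * (C * i.+1%:R `^ (- (1 + beta))) by ring.
by rewrite ler_wpM2l.
Qed.

(** With [y = delta * a ^ alpha] and [p = 4 / alpha], the inequality
    [expR (y / p) >= y / p] raised to the power [p] bounds [expR y] below by a
    multiple of [y ^ p], that is of [a ^ 4].  The exponent is written [1 + 3]
    because it is used as [1 + beta] with [beta = 3]. *)
Lemma expR_decay (R : realType) (alpha delta : R) : 0 < alpha -> 0 < delta ->
  exists2 C : R, 0 < C &
    forall a : R, 0 < a -> expR (- delta * a `^ alpha) <= C * a `^ (- (1 + 3)).
Proof.
move=> al0 de0; pose p := 4 / alpha; have p0 : 0 < p by rewrite divr_gt0.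
have q0 : 0 < (delta / p) `^ p by rewrite powR_gt0// divr_gt0.
exists (((delta / p) `^ p)^-1) => [|a a0]; first by rewrite invr_gt0.
rewrite mulNr expRN powRN -invfM lef_pV2 ?posrE ?expR_gt0 ?(mulr_gt0 q0) ?powR_gt0//.
set y := delta * a `^ alpha.
have -> : expR y = expR (y / p) `^ p.
  by rewrite /powR expR_eq0 expRK mulrC divfK// gt_eqF.
have -> : (delta / p) `^ p * a `^ (1 + 3) = (y / p) `^ p.
  have -> : 1 + 3 = alpha * p by rewrite /p mulrC divfK ?gt_eqF//; ring.
  rewrite powRrM -powRM ?powR_ge0 ?divr_ge0 ?ltW//; congr (_ `^ _).
  by rewrite /y mulrAC.
rewrite ge0_ler_powR ?nnegrE ?expR_ge0 ?(ltW p0)//.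
  by rewrite divr_ge0 ?(ltW p0)// mulr_ge0 ?powR_ge0// ltW.
by apply: le_trans (expR_ge1Dx _); rewrite lerDr.
Qed.

Theorem corollary4p1 (R : realType) (k : int -> R) (hk : is_kernel k)
    (hclass : power_kernel k \/ exp_kernel k \/ exp_power_kernel k) :
  exists d : R, 0 < d /\ CD0 k d.
Proof.
have powle (s : R) (i j : nat) : 0 < s -> (0 < i <= j)%N ->
    0 < (i%:R `^ s : R) <= j%:R `^ s.
  move=> s0 /andP[i0 ij]; rewrite powR_gt0 ?ltr0n//=.
  by rewrite ge0_ler_powR ?nnegrE ?ler0n ?ler_nat// ltW.
have posz (i j : nat) : (0 < i <= j)%N -> i%:Z != 0 /\ j%:Z != 0.
  by case: i j => [|i] [|j].
case: hclass => [[c [beta [c0 beta2 kE]]]|[|]].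
- have beta0 : 0 < 1 + beta by lra.
  apply: (@CD0_of_power_decay R k c beta) => //; last 2 first.
  + exact: ltW.
  + by move=> n; rewrite kE// powRN.
  move=> i j ij; have [i0 j0] := posz i j ij; rewrite !kE//.
  have /andP[pi pij] := powle _ _ _ beta0 ij.
  by rewrite ler_wpM2l ?(ltW c0)// lef_pV2 ?posrE// (lt_le_trans pi).
- move=> [c [alpha [delta [c0 al0 de0 kE]]]].
  have [C C0 hC] := expR_decay _ _ _ al0 de0.
  apply: (@CD0_of_power_decay R k (c * C) 3) => //; last 3 first.
  + by lra.
  + by rewrite mulr_ge0// ltW.
  + by move=> n; rewrite kE// -mulrA ler_wpM2l ?(ltW c0)// hC.
  move=> i j ij; have [i0 j0] := posz i j ij; rewrite !kE//.
  have /andP[_ pij] := powle _ _ _ al0 ij.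
  by rewrite ler_wpM2l ?(ltW c0)// ler_expR !mulNr lerN2 ler_wpM2l// ltW.
- move=> [c [alpha [delta [c0 al0 de0 kE]]]].
  have [C C0 hC] := expR_decay _ _ _ (@ltr01 R) de0.
  apply: (@CD0_of_power_decay R k (c * C) 3) => //; last 3 first.
  + by lra.
  + by rewrite mulr_ge0// ltW.
  + move=> n; rewrite kE// -mulrA ler_wpM2l ?(ltW c0)//.
    (* the factor n ^ (- alpha) is at most 1 *)
    apply: le_trans (hC n.+1%:R _) => //; rewrite powRr1//.
    have /andP[p1 pn] := powle alpha 1%N n.+1 al0 isT.
    rewrite ler_pdivrMr ?(lt_le_trans p1)// ler_peMr ?expR_ge0//.
    by rewrite powR1 in pn.
  move=> i j ij; have [i0 j0] := posz i j ij; rewrite !kE//.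
  have /andP[pi pij] := powle _ _ _ al0 ij.
  rewrite ler_wpM2l ?(ltW c0)// ler_pM ?expR_ge0 ?invr_ge0 ?powR_ge0//.
    rewrite ler_expR !mulNr lerN2 ler_wpM2l ?(ltW de0)// ler_nat.
    by case/andP: ij.
  by rewrite lef_pV2 ?posrE// (lt_le_trans pi).
Qed.
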